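(* Let $(R,\mathfrak m,K)$ be a one-dimensional local ring, and let $M$ be an $R$-module of finite length and infinite projective dimension. Then $\lambda(\Omega_1(M))=\lambda(\Omega_3(M))=\infty$.
   Context: Rings are commutative and Noetherian; $\lambda$ denotes length. For a minimal free resolution $\cdots\to G_1\xrightarrow{\varphi_1}G_0\to M\to 0$ of $M$ (finitely generated free modules, $\operatorname{Im}(\varphi_{j+1})\subseteq\mathfrak mG_j$), the syzygies are $\Omega_0(M)=M$ and $\Omega_i(M)=\operatorname{Im}(\varphi_i)\subseteq G_{i-1}$ for $i\ge1$. *)

(* Defs.v *)
From HB Require Import structures.
From mathcomp Require Import all_boot all_order all_algebra.
From mathcomp Require Import all_classical.
From mathcomp Require Import constructive_ereal.

Set Implicit Arguments.
Unset Strict Implicit.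
Unset Printing Implicit Defensive.

Import Order.TTheory GRing.Theory.

Local Open Scope classical_set_scope.
Local Open Scope ring_scope.

(* In [\bar nat] the points at infinity are the genuine values +oo and -oo;
   [supremum 0%N] is only reached on nonempty bounded sets. *)
Definition nat_sup (A : set nat) : \bar nat :=
  if `[< A = set0 >] then -oo%E
  else if `[< has_ubound A >] then (supremum 0%N A)%:E
  else +oo%E.

Section Rings.
Variable R : comNzRingType.

Definition ideal (I : set R) : Prop := @GRing.submod_closed R R^o [in I].

Definition noetherian : Prop :=
  forall I : set R, ideal I ->
    exists (n : nat) (a : 'I_n -> R),
      I = [set x | exists c : 'I_n -> R, x = \sum_(i < n) c i * a i].

(* [idealr_closed] only describes proper ideals: it includes 1 \notin I. *)
Definition maximal_ideal (I : set R) : Prop :=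
  idealr_closed [in I] /\
  forall J : set R, idealr_closed [in J] -> I `<=` J -> J = I.

Definition prime_ideal (p : set R) : Prop :=
  idealr_closed [in p] /\ prime_idealr_closed [in p].

Definition local_with (m : set R) : Prop :=
  maximal_ideal m /\ forall n : set R, maximal_ideal n -> n = m.

Definition krull_dim : \bar nat :=
  nat_sup [set n | exists p : nat -> set R,
    (forall i, (i <= n)%N -> prime_ideal (p i)) /\
    (forall i, (i < n)%N -> p i `<` p i.+1)].

End Rings.

Section Modules.
Variable R : comNzRingType.

Definition submodule (V : lmodType R) (N : set V) : Prop :=
  GRing.submod_closed [in N].

(* Length of a submodule N of V: supremum of the lengths of strict chains
   of submodules contained in N. *)
Definition len (V : lmodType R) (N : set V) : \bar nat :=
  nat_sup [set n | exists C : nat -> set V,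
    (forall i, (i <= n)%N -> submodule (C i) /\ C i `<=` N) /\
    (forall i, (i < n)%N -> C i `<` C i.+1)].

Definition ideal_mul (I : set R) (V : lmodType R) : set V :=
  [set v | exists (n : nat) (a : 'I_n -> R) (g : 'I_n -> V),
     (forall i, I (a i)) /\ v = \sum_(i < n) a i *: g i].

Arguments ideal_mul I V : clear implicits.

Definition fg_free (V : lmodType R) : Prop :=
  exists (n : nat) (f : {linear 'rV[R]_n -> V}), bijective f.

Definition projective (P : lmodType R) : Prop :=
  forall (A B : lmodType R) (g : {linear A -> B}) (f : {linear P -> B}),
    range g = setT -> exists h : {linear P -> A}, forall x, g (h x) = f x.

Record resolution (M : lmodType R) := Resolution {
  term : nat -> lmodType R;
  diff : forall j : nat, {linear term j.+1 -> term j};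
  aug : {linear term 0%N -> M};
  aug_surj : range aug = setT;
  exact_aug : range (diff 0) = aug @^-1` [set 0];
  exact_diff : forall j, range (diff j.+1) = diff j @^-1` [set 0]
}.

Definition minimal_free_resolution (m : set R) (M : lmodType R)
    (G : resolution M) : Prop :=
  (forall i, fg_free (term G i)) /\
  (forall j, range (diff G j) `<=` ideal_mul m (term G j)).

Definition proj_dim_le (M : lmodType R) (n : nat) : Prop :=
  exists P : resolution M,
    (forall i, projective (term P i)) /\
    (forall i, (n < i)%N -> forall x : term P i, x = 0).

Definition infinite_proj_dim (M : lmodType R) : Prop :=
  forall n, ~ proj_dim_le M n.

Definition syzygy_ambient (M : lmodType R) (G : resolution M) (i : nat) :
    lmodType R :=
  if i is j.+1 then term G j else M.

(* [diff G j] is the map phi_(j+1) : G_(j+1) -> G_j. *)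
Definition syzygy (M : lmodType R) (G : resolution M) (i : nat) :
    set (syzygy_ambient G i) :=
  match i with
  | 0 => setT
  | j.+1 => range (diff G j)
  end.

End Modules.

Arguments syzygy {R M} G i _.

(* Main.v *)
(** For a module [V] let Gam(V) be the union of its submodules of finite length.
    Since [R] is Noetherian, Gam(R) has a finite length n, so Gam(R^b) has
    length b * n.  Suppose that Omega_3 has finite length.  Then Gam(G_2) maps
    onto Gam(Omega_2) with kernel Omega_3, while Gam(G_1) / Gam(Omega_2) embeds
    into Gam(G_0); with b_i the rank of G_i this gives
    b_1 n + len Omega_3 <= (b_0 + b_2) n.  Dimension one provides primes
    p < q, and elements of finite length vanish after localizing at p, so the
    complex G_2 -> G_1 -> G_0 becomes split exact there and b_0 + b_2 <= b_1.
    Hence Omega_3 = 0 and the projective dimension of [M] is at most 2.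
    If Omega_1 has finite length, then so have G_0 and [R], and 1 would be
    killed by an element outside p. *)

From HB Require Import structures.
Require Import Defs.
From mathcomp Require Import all_boot all_order all_algebra.
From mathcomp Require Import all_classical.
From mathcomp Require Import constructive_ereal.
From mathcomp Require Import zify.

Set Implicit Arguments.
Unset Strict Implicit.
Unset Printing Implicit Defensive.

Import Order.TTheory GRing.Theory.

Local Open Scope classical_set_scope.
Local Open Scope ring_scope.

(** * Suprema of sets of natural numbers *)

Lemma nat_sup_fin_bound (A : set nat) (n : nat) :
  nat_sup A = n%:E -> exists b : nat, forall k, A k -> (k <= b)%N.
Proof.
by rewrite /nat_sup; case: asboolP => // _; case: asboolP.
Qed.

Lemma nat_sup_bound (A : set nat) :
  A !=set0 -> nat_sup A <> +oo%E -> exists b : nat, forall k, A k -> (k <= b)%N.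
Proof.
move=> A0; rewrite /nat_sup; case: asboolP => [Ae|_].
  by case: A0 => k; rewrite Ae.
by case: asboolP.
Qed.

(** If no element were positive, the nonempty set [A] would be {0}, with supremum 0. *)
Lemma nat_sup1 (A : set nat) :
  nat_sup A = 1%N%:E -> exists k : nat, A k /\ (0 < k)%N.
Proof.
rewrite /nat_sup; case: asboolP => // A0; case: asboolP => // _ A1.
apply/not_existsP => nA.
have {}nA k : A k -> k = 0%N.
  by move=> Ak; apply/eqP; rewrite eqn0Ngt; apply/negP => k0; apply: (nA k).
have eA : A = [set 0%N].
  apply/seteqP; split=> [k /nA //|k -> /=].
  case/eqP/set0P: A0 => j Aj; by rewrite -(nA _ Aj).
by move: A1; rewrite eA supremum1.
Qed.

(** * Lengths of submodules *)

Section Submodules.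
Variable R : comNzRingType.
Implicit Types V W : lmodType R.

Definition linear_of V W (f : V -> W) (lin_f : linear f) : {linear V -> W} :=
  HB.pack f (GRing.isLinear.Build _ _ _ _ _ lin_f).

Lemma submoduleP V (N : set V) :
  submodule N <-> N 0 /\ forall a u v, N u -> N v -> N (a *: u + v).
Proof.
split=> [[N0 Nl]|[N0 Nl]]; split.
- by rewrite inE in N0.
- by move=> a u v Nu Nv; have := Nl a u v; rewrite !inE; exact.
- by rewrite inE.
- by move=> a u v; rewrite !inE; exact: Nl.
Qed.

Lemma submodule0 V : submodule [set 0 : V].
Proof. by apply/submoduleP; split=> //= a u v -> ->; rewrite scaler0 addr0. Qed.

Lemma submoduleT V : submodule [set: V].
Proof. by apply/submoduleP. Qed.

Lemma submoduleI V (A B : set V) :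
  submodule A -> submodule B -> submodule (A `&` B).
Proof.
move=> /submoduleP[A0 Al] /submoduleP[B0 Bl]; apply/submoduleP; split=> //.
by move=> a u v [Au Bu] [Av Bv]; split; [exact: Al | exact: Bl].
Qed.

Lemma submodule_image V W (f : {linear V -> W}) (A : set V) :
  submodule A -> submodule (f @` A).
Proof.
move=> /submoduleP[A0 Al]; apply/submoduleP; split.
  by exists 0 => //; rewrite linear0.
move=> a _ _ [u Au <-] [v Av <-]; exists (a *: u + v); first exact: Al.
by rewrite linearP.
Qed.

Lemma submodule_preimage V W (f : {linear V -> W}) (B : set W) :
  submodule B -> submodule (f @^-1` B).
Proof.
move=> /submoduleP[B0 Bl]; apply/submoduleP; split; first by rewrite /= linear0.
by move=> a u v Bu Bv; rewrite /= linearP; exact: Bl.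
Qed.

Lemma submodule_kernel V W (f : {linear V -> W}) :
  submodule (f @^-1` [set 0]).
Proof. exact/submodule_preimage/submodule0. Qed.

Lemma submodule_line V (v : V) : submodule (range (fun r : R => r *: v)).
Proof.
apply/submoduleP; split; first by exists 0 => //; rewrite scale0r.
move=> a _ _ [r _ <-] [s _ <-]; exists (a * r + s) => //.
by rewrite scalerDl scalerA.
Qed.

(** * Strict chains and additivity of length *)

(** The condition inside [len], named so that lengths can be compared in [nat], without extended
    values. *)
Definition has_chain V (N : set V) (n : nat) : Prop :=
  exists C : nat -> set V,
    (forall i, (i <= n)%N -> submodule (C i) /\ C i `<=` N) /\
    (forall i, (i < n)%N -> C i `<` C i.+1).

Lemma has_chain0 V (N : set V) : submodule N -> has_chain N 0.
Proof. by move=> sN; exists (fun=> N); split=> // i _; split. Qed.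

Lemma has_chainW V (A B : set V) n :
  A `<=` B -> has_chain A n -> has_chain B n.
Proof.
move=> AB [C [C1 C2]]; exists C; split=> // i /C1[sC CA]; split=> //.
exact: subset_trans AB.
Qed.

Lemma has_chainS V (N N' : set V) n :
  submodule N -> N' `<` N -> has_chain N' n -> has_chain N n.+1.
Proof.
move=> sN [N'N nNN'] [C [C1 C2]].
exists (fun i => if (i <= n)%N then C i else N); split=> i.
  move=> _; case: ifP => [/C1[sC CN']|_]; last by split.
  by split=> //; exact: subset_trans CN' N'N.
rewrite ltnS => lein; rewrite lein.
case: ltnP => [/C2 //|lein']; have [_ CN'] := C1 _ lein; split.
  exact: subset_trans N'N.
by move=> NC; apply: nNN'; exact: subset_trans CN'.
Qed.

(** [N'] is the last member but one; monotonicity puts all earlier members inside it. With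
    [has_chainS], this allows induction by peeling off the top of a chain. *)
Lemma has_chainSP V (N : set V) n :
  has_chain N n.+1 -> exists N', [/\ submodule N', N' `<` N & has_chain N' n].
Proof.
case=> C [C1 C2]; have [sC _] := C1 n (leqnSn n).
exists (C n); split=> //.
  have [_ CN] := C1 _ (leqnn n.+1); have [CC nCC] := C2 _ (ltnSn n).
  split; first exact: subset_trans CN.
  by move=> NC; apply: nCC; exact: subset_trans NC.
exists C; split=> [i lein|i ltin].
  split; first by have [] := C1 _ (leq_trans lein (leqnSn n)).
  elim: {C1 sC} n lein C2 => [|n IH]; first by rewrite leqn0 => /eqP -> _ t.
  rewrite leq_eqVlt => /predU1P[-> _ t //|]; rewrite ltnS => /IH{}IH C2.
  apply: subset_trans (IH _) _; first by move=> j jn; apply: C2; lia.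
  by have [] := C2 n (leqnSn _).
by apply: C2; lia.
Qed.

(** The chain of the image is pulled back and stacked on that of the kernel: the preimage of [D] in
    [E] still contains the kernel part and maps onto [D]. *)
Lemma has_chain_extension V W (f : {linear V -> W}) (E : set V) a b :
  submodule E -> has_chain (E `&` f @^-1` [set 0]) a -> has_chain (f @` E) b ->
  has_chain E (a + b).
Proof.
elim: b E => [|b IH] E sE cK.
  by rewrite addn0 => _; apply: has_chainW cK => v [].
move=> /has_chainSP[D [sD [DE nED] cD]]; rewrite addnS.
have sE' : submodule (E `&` f @^-1` D).
  by apply: submoduleI => //; exact: submodule_preimage.
apply: (has_chainS (N' := E `&` f @^-1` D)) => //.
  split=> [v [] //|EE']; apply: nED => _ [v Ev <-].
  by have [] := EE' _ Ev.
apply: IH => //.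
  apply: has_chainW cK => v [Ev fv0]; do 2!split=> //.
  by rewrite /= fv0; have /submoduleP[] := sD.
apply: has_chainW cD => w Dw; have [v Ev fvw] := DE _ Dw.
by exists v => //; split=> //=; rewrite fvw.
Qed.

(** Each strict step of a chain in [E] stays strict in the kernel part or in the image, so it is
    counted at least once. *)
Lemma has_chain_split V W (f : {linear V -> W}) (E : set V) n :
  submodule E -> has_chain E n ->
  exists a b, [/\ (n <= a + b)%N, has_chain (E `&` f @^-1` [set 0]) a &
                  has_chain (f @` E) b].
Proof.
elim: n E => [|n IH] E sE.
  move=> _; exists 0%N, 0%N; split=> //; apply: has_chain0.
    by apply: submoduleI => //; exact: submodule_kernel.
  exact: submodule_image.
move=> /has_chainSP[D [sD [DE nED] cD]].
have [a [b [nab ca cb]]] := IH _ sD cD.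
have sKE : submodule (E `&` f @^-1` [set 0]).
  by apply: submoduleI => //; exact: submodule_kernel.
have [KK|nKK] := pselect (E `&` f @^-1` [set 0] `<=` D `&` f @^-1` [set 0]).
  exists a, b.+1; split; first by lia.
    by apply: has_chainW ca => v [Dv fv]; split=> //; exact: DE.
  apply: has_chainS cb; first exact: submodule_image.
  split; first exact: image_subset.
  (* With equal images, [v] in [E] has the same value as some [w] in [D]; then v - w lies in the
     kernel part, which is inside [D], and so does [v]. *)
  move=> fEfD; apply: nED => v Ev.
  have [|w Dw fwv] := fEfD (f v); first by exists v.
  have /submoduleP[E0 El] := sE; have /submoduleP[D0 Dl] := sD.
  have [|D1 _] := KK ((-1) *: w + v).
    split; first by apply: El => //; exact: DE.
    by rewrite /= linearP fwv scaleN1r addNr.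
  have := Dl 1 _ _ Dw D1; by rewrite scale1r scaleN1r addrA subrr add0r.
exists a.+1, b; split; first by lia.
  apply: has_chainS ca => //; split=> // v [Dv fv]; split=> //; exact: DE.
by apply: has_chainW cb; exact: image_subset.
Qed.

Definition has_length V (N : set V) (n : nat) : Prop :=
  has_chain N n /\ forall k, has_chain N k -> (k <= n)%N.

Definition finite_length V (N : set V) : Prop :=
  exists n : nat, forall k, has_chain N k -> (k <= n)%N.

Lemma has_length_finite V (N : set V) n : has_length N n -> finite_length N.
Proof. by case=> _ H; exists n. Qed.

Lemma finite_has_length V (N : set V) :
  submodule N -> finite_length N -> exists n, has_length N n.
Proof.
move=> sN [n]; elim: n => [|n IH] H.
  by exists 0%N; split=> //; exact: has_chain0.
have [c|nc] := pselect (has_chain N n.+1); first by exists n.+1.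
apply: IH => k ck; have := H k ck; rewrite leq_eqVlt => /predU1P[kn|//].
by case: nc; rewrite -kn.
Qed.

Lemma finite_lengthW V (A B : set V) :
  A `<=` B -> finite_length B -> finite_length A.
Proof. by move=> AB [n Bn]; exists n => k /(has_chainW AB)/Bn. Qed.

Lemma has_length_le V (A B : set V) a b :
  A `<=` B -> has_length A a -> has_length B b -> (a <= b)%N.
Proof. by move=> AB [cA _] [_ HB]; apply: HB; exact: has_chainW cA. Qed.

Lemma has_length_unique V (A : set V) a b :
  has_length A a -> has_length A b -> a = b.
Proof.
move=> Aa Ab; apply/eqP; rewrite eqn_leq.
by rewrite (has_length_le _ Aa Ab) // (has_length_le _ Ab Aa).
Qed.

Lemma has_length_add V W (f : {linear V -> W}) (E : set V) a b :
  submodule E -> has_length (E `&` f @^-1` [set 0]) a ->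
  has_length (f @` E) b -> has_length E (a + b).
Proof.
move=> sE [ca Ha] [cb Hb]; split; first exact: has_chain_extension ca cb.
move=> k /(has_chain_split f sE)[a' [b' [kab /Ha a'a /Hb b'b]]].
by apply: leq_trans kab _; exact: leq_add.
Qed.

Lemma finite_length_extension V W (f : {linear V -> W}) (E : set V) :
  submodule E -> finite_length (E `&` f @^-1` [set 0]) ->
  finite_length (f @` E) -> finite_length E.
Proof.
move=> sE /finite_has_length[|a Ha].
  by apply: submoduleI => //; exact: submodule_kernel.
move=> /finite_has_length[|b Hb]; first exact: submodule_image.
by move: (has_length_add sE Ha Hb); exact: has_length_finite.
Qed.

Lemma finite_length_image V W (f : {linear V -> W}) (E : set V) :
  submodule E -> finite_length E -> finite_length (f @` E).
Proof.
move=> sE [n En]; exists n => k ck; rewrite -(add0n k); apply: En.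
apply: has_chain_extension ck => //; apply: has_chain0.
by apply: submoduleI => //; exact: submodule_kernel.
Qed.

Lemma finite_length_preimage V W (f : {linear V -> W}) (B : set W) :
  submodule B -> finite_length (f @^-1` [set 0]) -> finite_length B ->
  finite_length (f @^-1` B).
Proof.
move=> sB fK fB; apply: (finite_length_extension (f := f)).
- exact: submodule_preimage.
- by apply: finite_lengthW fK => v [].
- by apply: finite_lengthW fB => _ [v Bv <-].
Qed.

Lemma has_length0 V (N : set V) : N `<=` [set 0] -> submodule N ->
  has_length N 0.
Proof.
move=> N0 sN; split; first exact: has_chain0.
case=> // k /has_chainSP[D [/submoduleP[D0 _] [_ nND] _]].
by case: nND => v /N0 ->.
Qed.

Lemma has_length_image_inj V W (f : {linear V -> W}) (E : set V) n :
  submodule E -> (forall v, f v = 0 -> v = 0) -> has_length E n ->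
  has_length (f @` E) n.
Proof.
move=> sE f0 En.
have [||b Hb] := @finite_has_length _ (f @` E); first exact: submodule_image.
  by apply: finite_length_image => //; exact: has_length_finite En.
suff H : has_length E (0 + b).
  by rewrite (has_length_unique En H).
apply: has_length_add Hb => //; apply: has_length0 => [v [_ /f0] //|].
by apply: submoduleI => //; exact: submodule_kernel.
Qed.

Lemma has_length_eq0 V (N : set V) : submodule N -> has_length N 0 ->
  N `<=` [set 0].
Proof.
move=> sN [_ H] v Nv; apply: contrapT => v0.
have /H : has_chain N 1; last by [].
apply: (has_chainS (N' := [set 0])) => //; last exact/has_chain0/submodule0.
split=> [_ ->|]; first by have /submoduleP[] := sN.
by move=> /(_ _ Nv).
Qed.

(** [N] is A + B, the image under addition of A x B, which is an extension of [A] by a copy of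
    [B]. *)
Lemma finite_length_sum V (A B : set V) :
  submodule A -> submodule B -> finite_length A -> finite_length B ->
  exists N, [/\ submodule N, finite_length N, A `<=` N & B `<=` N].
Proof.
move=> sA sB fA fB.
pose P : set (V * V) := [set w | A w.1 /\ B w.2].
have sP : submodule P.
  have /submoduleP[A0 Al] := sA; have /submoduleP[B0 Bl] := sB.
  apply/submoduleP; split=> // a u v [Au Bu] [Av Bv].
  by split; [exact: Al|exact: Bl].
have lin_add : linear (fun w : V * V => w.1 + w.2).
  by move=> a u v /=; rewrite scalerDr addrACA.
have lin_inr : linear (fun v : V => (0, v) : V * V).
  by move=> a u v; congr pair; rewrite /= scaler0 addr0.
have lin_fst : linear (fun w : V * V => w.1) by move=> a u v.
pose add := linear_of lin_add.
pose inr := linear_of lin_inr.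
pose fs := linear_of lin_fst.
have fP : finite_length P.
  apply: (finite_length_extension (f := fs)) => //.
    apply: finite_lengthW (finite_length_image inr sB fB).
    by move=> [u v] [[/= _ Bv] ->]; exists v.
  by apply: finite_lengthW fA => _ [[u v] [/= Au _] <-].
exists (add @` P); split; [exact: submodule_image|exact: finite_length_image| |].
  move=> v Av; exists (v, 0); rewrite /= ?addr0 //.
  by split=> //; have /submoduleP[] := sB.
move=> v Bv; exists (0, v); rewrite /= ?add0r //.
by split=> //; have /submoduleP[] := sA.
Qed.

(** * The part of finite length of a module *)

(** Over a Noetherian local ring this is the zeroth local cohomology at the maximal ideal. *)
Definition finite_part V : set V :=
  [set v | exists N, [/\ submodule N, finite_length N & N v]].

Lemma finite_part_sub V (N : set V) :
  submodule N -> finite_length N -> N `<=` @finite_part V.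
Proof. by move=> sN fN v Nv; exists N. Qed.

Lemma submodule_finite_part V : submodule (@finite_part V).
Proof.
apply/submoduleP; split.
  exists [set 0]; split=> //; first exact: submodule0.
  by apply: has_length_finite (has_length0 _ _) => //; exact: submodule0.
move=> a u v [A [sA fA Au]] [B [sB fB Bv]].
have [N [sN fN AN BN]] := finite_length_sum sA sB fA fB.
exists N; split=> //; have /submoduleP[_ Nl] := sN.
by apply: Nl; [exact: AN|exact: BN].
Qed.

Lemma finite_part_image V W (f : {linear V -> W}) v :
  finite_part v -> finite_part (f v).
Proof.
move=> [N [sN fN Nv]]; exists (f @` N); split; last by exists v.
  exact: submodule_image.
exact: finite_length_image.
Qed.

(** The preimage of a finite-length submodule is an extension of a part of it by the kernel. *)
Lemma finite_part_preimage V W (f : {linear V -> W}) v :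
  finite_length (f @^-1` [set 0]) -> finite_part (f v) -> finite_part v.
Proof.
move=> fK [N [sN fN Nv]]; exists (f @^-1` N); split=> //.
  exact: submodule_preimage.
exact: finite_length_preimage.
Qed.

(** The finite part is an ideal, so it has finitely many generators; each lies in a submodule of
    finite length, and the sum of these contains the ideal. *)
Lemma finite_length_finite_part_ring :
  noetherian R -> finite_length (@finite_part R^o).
Proof.
move=> /(_ _ (submodule_finite_part R^o))[n [a Ha]].
have Fa i : finite_part (a i : R^o).
  rewrite Ha /=; exists (fun j => (j == i)%:R).
  rewrite (bigD1 i) //= eqxx mul1r big1 ?addr0 // => j /negPf ->.
  by rewrite mul0r.
suff [N [sN fN Na]] : exists N : set R^o,
    [/\ submodule N, finite_length N & forall i, N (a i)].
  apply: finite_lengthW fN; rewrite Ha => _ [c ->].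
  have /submoduleP[N0 Nl] := sN.
  by apply: (big_rec N) => // i x _ Nx; apply: (Nl (c i)).
clear Ha; elim: n a Fa => [|n IH] a Fa.
  exists [set 0]; split; [exact: submodule0| |by case].
  by apply: has_length_finite (has_length0 _ _) => //; exact: submodule0.
have [N [sN fN Na]] := IH (fun i => a (lift ord0 i)) (fun i => Fa _).
have [B [sB fB Ba]] := Fa ord0.
have [C [sC fC NC BC]] := finite_length_sum sN sB fN fB.
exists C; split=> // i; case: (unliftP ord0 i) => [j ->|->]; first exact: NC.
exact: BC.
Qed.

(** Induction along the split sequence R^b -> R^(1+b) -> R given by [cs] and [hd]. The section [sc]
    makes [hd] surjective on finite parts. *)
Lemma has_length_finite_part_row n b :
  has_length (@finite_part R^o) n -> has_length (@finite_part 'rV[R]_b) (b * n).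
Proof.
move=> Hn; elim: b => [|b IH].
  apply: has_length0; last exact: submodule_finite_part.
  by move=> v _; apply/rowP; case.
rewrite -[b.+1]/(1 + b)%N.
have lin_hd : linear (fun v : 'rV[R]_(1 + b) => v 0 (lshift b 0) : R^o).
  by move=> a u v; rewrite !mxE.
have lin_cs : linear (fun v : 'rV[R]_b => row_mx (0 : 'rV_1) v).
  by move=> a u v; rewrite scale_row_mx add_row_mx scaler0 addr0.
have lin_sc :
    linear (fun r : R^o => r *: (delta_mx 0 (lshift b 0) : 'rV[R]_(1 + b))).
  by move=> a u v; rewrite scalerDl -scalerA.
pose hd := linear_of lin_hd.
pose cs := linear_of lin_cs.
pose sc := linear_of lin_sc.
have cs0 v : cs v = 0 -> v = 0.
  move=> /rowP csv; apply/rowP => i; have := csv (rshift 1 i).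
  by rewrite /= row_mxEr !mxE.
rewrite mulnDl mul1n (addnC n); apply: (@has_length_add _ _ hd).
- exact: submodule_finite_part.
- suff -> : @finite_part _ `&` hd @^-1` [set 0] = cs @` (@finite_part _).
    by apply: has_length_image_inj IH => //; exact: submodule_finite_part.
  apply/seteqP; split=> [v [Fv v0]|_ [v Fv <-]]; last first.
    split; first exact: finite_part_image.
    by rewrite /= row_mxEl mxE.
  have vE : v = cs (rsubmx v).
    rewrite -[LHS]hsubmxK /=; congr row_mx.
    by apply/rowP => i; rewrite ord1 !mxE -[RHS]v0.
  exists (rsubmx v) => //.
  apply: (@finite_part_preimage _ _ cs); last by rewrite -vE.
  apply: has_length_finite (has_length0 _ _); last exact: submodule_kernel.
  by move=> w /cs0.
- suff -> : hd @` (@finite_part _) = @finite_part _ by [].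
  apply/seteqP; split=> [_ [v Fv <-]|r Fr]; first exact: finite_part_image.
  exists (sc r); first exact: finite_part_image.
  by rewrite /= !mxE !eqxx mulr1.
Qed.

Lemma has_length_finite_part_free V n b (f : {linear 'rV[R]_b -> V}) :
  has_length (@finite_part R^o) n -> bijective f ->
  has_length (@finite_part V) (b * n).
Proof.
move=> Hn [g fK gK].
have f0 v : f v = 0 -> v = 0 by move=> fv; rewrite -(fK v) fv -(linear0 f) fK.
suff -> : @finite_part V = f @` (@finite_part _).
  apply: has_length_image_inj; first exact: submodule_finite_part.
    exact: f0.
  exact: has_length_finite_part_row.
apply/seteqP; split=> [v Fv|_ [v Fv <-]]; last exact: finite_part_image.
exists (g v); last exact: gK.
apply: (@finite_part_preimage _ _ f); last by rewrite gK.
apply: has_length_finite (has_length0 _ _); last exact: submodule_kernel.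
by move=> w /f0.
Qed.
(** * Elements of finite length and primes *)

Lemma idealr_closedE (p : set R) : idealr_closed [in p] ->
  [/\ p 0, ~ p 1 & forall a u v, p u -> p v -> p (a * u + v)].
Proof.
case; rewrite !inE => p0 p1 pl; split=> //.
  by move=> /mem_set; apply/negP.
by move=> a u v pu pv; have := pl a u v; rewrite !inE; exact.
Qed.

Lemma prime_idealM (p : set R) u v :
  prime_ideal p -> ~ p u -> ~ p v -> ~ p (u * v).
Proof. by case=> _ pp pu pv /mem_set/pp/orP[] /set_mem. Qed.

Lemma prime_ideal_prod (p : set R) (I : finType) (s : I -> R) :
  prime_ideal p -> (forall i, ~ p (s i)) -> ~ p (\prod_i s i).
Proof.
move=> pp ps; apply: (big_rec (fun x => ~ p x)).
  by have [/idealr_closedE[]] := pp.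
by move=> i x _; exact: prime_idealM.
Qed.

Lemma prime_idealX (p : set R) x n : prime_ideal p -> ~ p x -> ~ p (x ^+ n).
Proof.
move=> pp px; elim: n => [|n IH]; last by rewrite exprS; exact: prime_idealM.
by rewrite expr0; have [/idealr_closedE[]] := pp.
Qed.

(* For x in q but not in p, either some [x^i v] lies in [R x^(i+1) v], and then
   [x^i (1 - r x)] kills [v], or the submodules [R x^i v] form arbitrarily
   long strict chains. *)
Lemma finite_part_killed V (v : V) (p q : set R) :
  prime_ideal p -> prime_ideal q -> p `<` q -> finite_part v ->
  exists s, ~ p s /\ s *: v = 0.
Proof.
move=> pp [/idealr_closedE[q0 q1 ql] _] [pq nqp] [N [sN [l Nl] Nv]].
have [x [qx px]] : exists x, q x /\ ~ p x.
  apply: contrapT => /forallNP H; apply: nqp => x qx.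
  by apply: contrapT => px; apply: (H x).
have [[i [r E]]|H] := pselect (exists i r, x ^+ i *: v = r *: (x ^+ i.+1 *: v)).
  exists (x ^+ i * (1 - r * x)); split.
    apply: prime_idealM => //; first exact: prime_idealX.
    (* If 1 - r x were in [p], it would be in [q] together with r x, and so would 1. *)
    by move=> /pq /(ql r x _ qx); rewrite addrC subrK.
  by rewrite mulrBr mulr1 scalerBl E mulrCA -exprSr scalerA subrr.
have c k i : has_chain (range (fun r : R => r *: (x ^+ i *: v))) k.
  elim: k i => [|k IH] i; first exact/has_chain0/submodule_line.
  apply: has_chainS (IH i.+1); first exact: submodule_line.
  split=> [_ [r _ <-]|].
    by exists (r * x) => //; rewrite exprS -!scalerA.
  move=> /(_ (x ^+ i *: v)) [|r _ E]; first by exists 1 => //; rewrite scale1r.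
  by apply: H; exists i, r.
have /Nl : has_chain N l.+1; last by rewrite ltnn.
apply: has_chainW (c l.+1 0%N) => _ [r _ <-]; rewrite expr0 scale1r.
have /submoduleP[N0 Nlin] := sN.
by have := Nlin r v 0 Nv N0; rewrite addr0.
Qed.

(** * Free modules and ranks *)

(** Preimages chosen on the basis extend linearly. The condition on basis vectors suits maps into a
    kernel that exactness identifies with the range of [f]. *)
Lemma free_lift n V W (f : {linear V -> W}) (h : {linear 'rV[R]_n -> W}) :
  (forall i, exists v, f v = h (delta_mx 0 i)) ->
  exists k : {linear 'rV[R]_n -> V}, forall u, f (k u) = h u.
Proof.
move=> /choice[a fa].
have lin_k : linear (fun u : 'rV[R]_n => \sum_i u 0 i *: a i).
  move=> c u v; rewrite scaler_sumr -big_split; apply: eq_bigr => i _ /=.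
  by rewrite !mxE scalerDl scalerA.
exists (linear_of lin_k) => u /=; rewrite linear_sum [in RHS](row_sum_delta u).
by rewrite linear_sum; apply: eq_bigr => i _; rewrite !linearZ /= fa.
Qed.

(** Matrices act on row vectors from the right, so products below are read in the order in which the
    maps are applied. *)
Lemma free_lift_mx n b W (f : {linear 'rV[R]_b -> W})
    (h : {linear 'rV[R]_n -> W}) :
  (forall i, exists v, f v = h (delta_mx 0 i)) ->
  exists A : 'M[R]_(n, b), forall u, f (u *m A) = h u.
Proof.
by move=> /free_lift[k fk]; exists (lin1_mx k) => u; rewrite mul_rV_lin1 fk.
Qed.

Lemma fg_free_projective V : fg_free V -> projective V.
Proof.
case=> n [f [g fK gK]] A B F h Fsurj.
have lin_g : linear g.
  by move=> a u v; apply: (can_inj fK); rewrite linearP !gK.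
have [i|k Fk] := @free_lift n _ _ F (h \o f).
  have : range F (h (f (delta_mx 0 i))) by rewrite Fsurj.
  by case=> a _ Fa; exists a.
exists (k \o linear_of lin_g) => v /=.
by rewrite Fk /= gK.
Qed.

(** Padding [P] with zero columns and [Q] with zero rows keeps the product and makes both square;
    the padded [P] has a zero column. *)
Lemma det_mulmx_eq0 n k (P : 'M[R]_(n, k)) (Q : 'M[R]_(k, n)) :
  (k < n)%N -> \det (P *m Q) = 0.
Proof.
move=> kn; have nE : n = (k + (n - k.+1).+1)%N by lia.
move: (n - k.+1)%N nE P Q => d -> P Q {kn n}.
rewrite -[P *m Q]addr0 -(mul0mx _ (0 : 'M[R]_(d.+1, _))) -mul_row_col.
rewrite det_mulmx (expand_det_col _ (rshift k ord0)) big1 ?mul0r // => i _.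
by rewrite row_mxEr mxE mul0r.
Qed.

(* Over p, [col_mx B0 A2] splits [row_mx A1 (t *: B1)]: their product is block
   upper triangular, with determinant outside p, so it cannot factor through a
   free module of rank less than b0 + b2. *)
Lemma free_complex_rank (p : set R) b0 b1 b2 s t (A1 : 'M[R]_(b1, b0))
    (A2 : 'M[R]_(b2, b1)) (B0 : 'M[R]_(b0, b1)) (B1 : 'M[R]_(b1, b2)) :
  prime_ideal p -> ~ p s -> ~ p t ->
  B0 *m A1 = s%:M -> A2 *m A1 = 0 -> t *: (A2 *m B1) = (t * s)%:M ->
  (b0 + b2 <= b1)%N.
Proof.
move=> pp ps pt E0 E1 E2; rewrite leqNgt; apply/negP => lt.
have := @det_mulmx_eq0 _ _ (col_mx B0 A2) (row_mx A1 (t *: B1)) lt.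
rewrite mul_col_row E0 E1 -!scalemxAr E2 det_ublock !det_scalar => /(congr1 p).
have [/idealr_closedE[p0 _ _] _] := pp.
have : ~ p (s ^+ b0 * (t * s) ^+ b2).
  by apply: prime_idealM => //; apply: prime_idealX => //; exact: prime_idealM.
by move=> H E; apply: H; rewrite E.
Qed.
End Submodules.

(** * Truncating a resolution *)

Section TruncatedDiff.
Variable R : comNzRingType.
Implicit Types V W X : lmodType R.

Lemma row0_eq0 (x : 'rV[R]_0) : x = 0.
Proof. by apply/rowP; case. Qed.

(** [b] and [c] say whether source and target are kept or replaced by the zero module R^0; putting
    the choice into the type avoids casts. *)
Definition truncated_diff V W (d : {linear V -> W}) (b c : bool) :
    {linear (if b then V else 'rV[R]_0) -> (if c then W else 'rV[R]_0)} :=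
  match b, c with
  | true, true => d
  | _, _ => \0
  end.

Lemma range_truncated_diff V W (d : {linear V -> W}) b :
  (~~ b -> forall x, d x = 0) -> range (truncated_diff d b true) = range d.
Proof.
case: b => //= d0; apply/seteqP; split=> _ [x _ <-] /=.
  by exists 0; rewrite ?linear0.
by exists 0 => //=; rewrite d0.
Qed.

(** If the middle module is kept, so is the target, and a dropped source costs nothing because [d]
    is then zero. If it is dropped, both sides live in a zero module. *)
Lemma truncated_diff_exact V W X (d : {linear V -> W}) (e : {linear W -> X})
    (b c a : bool) :
  (b -> c) -> (c -> a) -> (c -> ~~ b -> forall x, d x = 0) ->
  range d = e @^-1` [set 0] ->
  range (truncated_diff d b c) = truncated_diff e c a @^-1` [set 0].
Proof.
case: c => [_ /(_ isT) -> /(_ isT) d0 <-|bc _ _ _].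
  exact: range_truncated_diff.
case: b bc => [/(_ isT)//|_]; apply/seteqP; split=> [_ [x _ <-]|x _] /=.
  by [].
by exists 0; rewrite // [RHS]row0_eq0.
Qed.
End TruncatedDiff.

Section Truncation.
Variables (R : comNzRingType) (M : lmodType R) (G : resolution M) (k : nat).
Hypothesis G_proj : forall i, projective (term G i).
Hypothesis G_stop : forall x, diff G k x = 0.

Let T i : lmodType R := if (i <= k)%N then term G i else 'rV[R]_0.
Let D j : {linear T j.+1 -> T j} :=
  truncated_diff (diff G j) (j < k)%N (j <= k)%N.

Lemma truncated_exact_aug : range (D 0) = aug G @^-1` [set 0].
Proof.
rewrite -exact_aug; apply: range_truncated_diff; rewrite -eqn0Ngt => /eqP k0.
by move: G_stop; rewrite k0.
Qed.

Lemma truncated_exact_diff j : range (D j.+1) = D j @^-1` [set 0].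
Proof.
apply: truncated_diff_exact (exact_diff G j); [exact: ltnW|exact: ltnW|].
move=> jk; rewrite -leqNgt => kj.
have jE : k = j.+1 by apply/eqP; rewrite eqn_leq kj.
by move: G_stop; rewrite jE.
Qed.

(** [diff G k] starts in degree k + 1. As it vanishes, exactness makes the map out of degree [k]
    injective, so cutting above degree [k] keeps a resolution. *)
Lemma proj_dim_le_truncation : proj_dim_le M k.
Proof.
exists (@Resolution R M T D (aug G) (aug_surj G) truncated_exact_aug
  truncated_exact_diff); split=> i /=.
  rewrite /T; case: ifP => _; first exact: G_proj.
  by apply: fg_free_projective; exists 0%N, idfun; exists id.
by rewrite /T ltnNge; case: (i <= k)%N => // _ x; exact: row0_eq0.
Qed.
End Truncation.

(** * Syzygies of a module of finite length *)

Section FiniteLengthSyzygies.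
Variables (R : comNzRingType) (M : lmodType R) (G : resolution M).
Variables (p q : set R).
Hypothesis p_prime : prime_ideal p.
Hypothesis q_prime : prime_ideal q.
Hypothesis lt_pq : p `<` q.
Hypothesis M_fin : finite_length [set: M].
Hypothesis G_free : forall i, fg_free (term G i).
Hypothesis M_pd : infinite_proj_dim M.

Lemma diff_diff j x : diff G j (diff G j.+1 x) = 0.
Proof.
have : range (diff G j.+1) (diff G j.+1 x) by exists x.
by rewrite exact_diff.
Qed.

Lemma syzygy1_infinite : ~ finite_length (range (diff G 0)).
Proof.
move=> f1; have [[|b] [f [g fK gK]]] := G_free 0.
  (* If G_0 has rank 0, then [diff G 0] is zero and the projective dimension is at most 0. *)
  apply: (M_pd (n := 0%N)); apply: (proj_dim_le_truncation (G := G)).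
    by move=> i; exact: fg_free_projective.
  by move=> x; rewrite -(gK (diff G 0 x)) (row0_eq0 (g _)) linear0.
have lin_g : linear g.
  by move=> a u v; apply: (can_inj fK); rewrite linearP !gK.
have lin_hd : linear (fun v : 'rV[R]_b.+1 => v 0 0 : R^o).
  by move=> a u v; rewrite !mxE.
have fG : finite_length [set: term G 0].
  apply: (@finite_length_extension _ _ _ (aug G)); first exact: submoduleT.
    by rewrite setTI -exact_aug.
  exact: finite_lengthW (@subsetT _ _) M_fin.
(* 1 is the first coordinate of a basis vector, so it lies in an image of G_0. *)
have F1 : finite_part (1 : R^o).
  exists [set (linear_of lin_hd \o linear_of lin_g) x | x in [set: term G 0]].
  split; first exact/submodule_image/submoduleT.
    exact/finite_length_image/fG/submoduleT.
  by exists (f (delta_mx 0 0)) => //=; rewrite fK mxE !eqxx.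
have [s [ps s0]] := finite_part_killed p_prime q_prime lt_pq F1.
apply: ps; have [/idealr_closedE[p0 _ _] _] := p_prime.
by move: s0; rewrite /GRing.scale /= mulr1 => ->.
Qed.

(** [B0] and [B1] form a contracting homotopy up to the factors [s] and [t] outside [p], that is, a
    splitting after localization at [p]. *)
Lemma free_ranks b0 b1 b2 (f0 : {linear 'rV[R]_b0 -> term G 0})
    (f1 : {linear 'rV[R]_b1 -> term G 1}) (f2 : {linear 'rV[R]_b2 -> term G 2}) :
  bijective f0 -> bijective f1 -> bijective f2 ->
  finite_length (range (diff G 2)) -> (b0 + b2 <= b1)%N.
Proof.
move=> bij0 bij1 bij2 fin3.
have [A1 E1] : exists A, forall u, f0 (u *m A) = (diff G 0 \o f1) u.
  apply: free_lift_mx => i; case: bij0 => g _ gK.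
  by exists (g ((diff G 0 \o f1) (delta_mx 0 i))).
have [A2 E2] : exists A, forall u, f1 (u *m A) = (diff G 1 \o f2) u.
  apply: free_lift_mx => i; case: bij1 => g _ gK.
  by exists (g ((diff G 1 \o f2) (delta_mx 0 i))).
have FM (x : M) : finite_part x.
  by exists [set: M]; split=> //; exact: submoduleT.
have [s0 s0P] := choice (fun i =>
  finite_part_killed p_prime q_prime lt_pq (FM (aug G (f0 (delta_mx 0 i))))).
(* [s] kills the image in [M] of each basis vector of G_0, so multiplication by [s] on G_0 lifts to
   G_1. *)
pose s := \prod_i s0 i.
have ps : ~ p s by apply: prime_ideal_prod => // i; case: (s0P i).
have sM i : s *: aug G (f0 (delta_mx 0 i)) = 0.
  have [_ si] := s0P i.
  by rewrite /s (bigD1 i) //= mulrC -scalerA si scaler0.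
have [B0 F0] : exists B, forall u, (diff G 0 \o f1) (u *m B) = (f0 \o *:%R s) u.
  apply: free_lift_mx => i; case: bij1 => g _ gK.
  have : (aug G @^-1` [set 0]) (f0 (s *: delta_mx 0 i)).
    by rewrite /= !linearZ /= sM.
  by rewrite -exact_aug => -[x _ xE]; exists (g x); rewrite /= gK xE.
have BA : B0 *m A1 = s%:M.
  apply/row_matrixP => i; rewrite !rowE; apply: (bij_inj bij0).
  by rewrite mulmxA E1 F0 /= mul_mx_scalar.
have AA : A2 *m A1 = 0.
  apply/row_matrixP => i; rewrite !rowE; apply: (bij_inj bij0).
  by rewrite mulmxA E1 /= E2 /= diff_diff mulmx0 linear0.
(* s - A1 B0 followed by [A1] is zero, so it maps into the range of [diff G 1] and lifts to G_2. *)
have [B1 F1] : exists B, forall u,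
    (diff G 1 \o f2) (u *m B) = (f1 \o mulmxr (s%:M - A1 *m B0)) u.
  apply: free_lift_mx => i; case: bij2 => g _ gK.
  have : (diff G 0 @^-1` [set 0]) (f1 (delta_mx 0 i *m (s%:M - A1 *m B0))).
    rewrite /= -[LHS]E1 -mulmxA mulmxBl -mulmxA BA mul_mx_scalar mul_scalar_mx.
    by rewrite subrr mulmx0 linear0.
  by rewrite -exact_diff => -[x _ xE]; exists (g x); rewrite /= gK xE.
have BA1 : B1 *m A2 = s%:M - A1 *m B0.
  apply/row_matrixP => i; rewrite !rowE; apply: (bij_inj bij1).
  by rewrite mulmxA E2 F1 /=.
(* s - A2 B1 followed by [A2] is A2 A1 B0 = 0, so its values lie in Omega_3, of finite length by
   assumption; [t] will kill them. *)
have F3 i : finite_part (f2 (delta_mx 0 i *m (s%:M - A2 *m B1))).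
  exists (range (diff G 2)); split=> //; first exact/submodule_image/submoduleT.
  rewrite exact_diff /= -[LHS]E2 -mulmxA mulmxBl -mulmxA BA1.
  rewrite (mulmxBr A2) (mulmxA A2) AA.
  rewrite mul0mx subr0 mul_mx_scalar mul_scalar_mx.
  by rewrite subrr mulmx0 linear0.
have [t0 t0P] := choice (fun i =>
  finite_part_killed p_prime q_prime lt_pq (F3 i)).
pose t := \prod_i t0 i.
have pt : ~ p t by apply: prime_ideal_prod => // i; case: (t0P i).
have tE : t *: (A2 *m B1) = (t * s)%:M.
  apply/esym/eqP; rewrite -scale_scalar_mx -subr_eq0 -scalerBr; apply/eqP.
  apply/row_matrixP => i; rewrite rowE -scalemxAr; apply: (bij_inj bij2).
  have [_ ti] := t0P i.
  by rewrite row0 linear0 linearZ /= /t (bigD1 i) //= mulrC -scalerA ti scaler0.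
exact: free_complex_rank p_prime ps pt BA AA tE.
Qed.

Lemma syzygy3_infinite : noetherian R -> ~ finite_length (range (diff G 2)).
Proof.
move=> noeth fin3.
have [n Hn] := finite_has_length (submodule_finite_part R^o)
  (finite_length_finite_part_ring noeth).
have [b0 [f0 bij0]] := G_free 0; have [b1 [f1 bij1]] := G_free 1.
have [b2 [f2 bij2]] := G_free 2.
have rk := free_ranks bij0 bij1 bij2 fin3.
have L0 := has_length_finite_part_free Hn bij0.
have L1 := has_length_finite_part_free Hn bij1.
have L2 := has_length_finite_part_free Hn bij2.
have sub3 : submodule (range (diff G 2)) by exact/submodule_image/submoduleT.
have subG i : submodule (@finite_part _ (term G i)).
  exact: submodule_finite_part.
have finG i : finite_length (@finite_part _ (term G i)).
  have [b [f bij]] := G_free i.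
  exact: has_length_finite (has_length_finite_part_free Hn bij).
have [a La] := finite_has_length sub3 fin3.
pose I2 := diff G 1 @` (@finite_part _ (term G 2)).
have [|i2 Li2] := finite_has_length (submodule_image (diff G 1) (subG 2)).
  exact: finite_length_image.
(* Omega_3 has finite length, so it lies inside the finite part of G_2 and is the whole kernel
   there. *)
have E2 : (a + i2)%N = (b2 * n)%N.
  apply: has_length_unique L2; apply: has_length_add Li2 => //.
  rewrite -exact_diff (_ : _ `&` _ = range (diff G 2)) //.
  apply/seteqP; split=> [x []|x rx] //; split=> //.
  exact: finite_part_sub rx.
have [|i1 Li1] := finite_has_length (submodule_image (diff G 0) (subG 1)).
  exact: finite_length_image.
have sK : submodule (@finite_part _ (term G 1) `&` diff G 0 @^-1` [set 0]).
  by apply: submoduleI => //; exact: submodule_kernel.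
have [|k1 Lk1] := finite_has_length sK.
  by apply: finite_lengthW (finG 1%N) => x [].
have E1 : (k1 + i1)%N = (b1 * n)%N.
  by apply: has_length_unique L1; exact: has_length_add Li1.
have le1 : (i1 <= b0 * n)%N.
  apply: has_length_le Li1 L0 => _ [x Fx <-]; exact: finite_part_image.
(* A preimage in G_2 of an element of finite length is again one, since the kernel Omega_3 has
   finite length. *)
have le2 : (k1 <= i2)%N.
  apply: has_length_le Lk1 Li2 => x [Fx]; rewrite -exact_diff => -[y _ yx].
  exists y => //; apply: (@finite_part_preimage _ _ _ (diff G 1)).
    by rewrite -exact_diff.
  by rewrite yx.
(* a + b1 n = a + k1 + i1 <= a + i2 + b0 n = (b0 + b2) n <= b1 n. *)
have a0 : a = 0%N.
  have : ((b0 + b2) * n <= b1 * n)%N by rewrite leq_mul2r rk orbT.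
  by rewrite mulnDl; lia.
rewrite a0 in La; have om0 := has_length_eq0 sub3 La.
(* Omega_3 = 0 says that [diff G 2] vanishes, so [G] can be cut above degree 2. *)
apply: (M_pd (n := 2%N)); apply: (proj_dim_le_truncation (G := G)).
  by move=> i; exact: fg_free_projective.
by move=> x; apply: om0; exists x.
Qed.
End FiniteLengthSyzygies.

(** * From unbounded chains to infinite length *)

(** The one-term chain [N] makes the set of chain lengths nonempty, which rules out the value
    -oo. *)
Lemma len_infinite (R : comNzRingType) (V : lmodType R) (N : set V) :
  submodule N -> ~ finite_length N -> len N = +oo%E.
Proof.
move=> sN fN; apply: contrapT => H; apply: fN.
by apply: nat_sup_bound H; exists 0%N; exact: has_chain0.
Qed.

Theorem corollary5p10 (R : comNzRingType) (m : set R) (M : lmodType R)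
    (G : resolution M) :
  noetherian R ->
  local_with m ->
  krull_dim R = 1%N%:E ->
  (exists l : nat, len [set: M] = l%:E) ->
  infinite_proj_dim M ->
  minimal_free_resolution m G ->
  len (syzygy G 1) = +oo%E /\ len (syzygy G 3) = +oo%E.
Proof.
move=> noeth _ /nat_sup1[k [[C [Cp Clt]] k0]] [l /nat_sup_fin_bound M_fin] pd.
move=> [G_free _].
(* The first two primes of a chain of positive length serve as [p] and [q]. *)
have p0 := Cp 0%N (leq0n k); have p1 := Cp 1%N k0; have lt01 := Clt 0%N k0.
split; apply: len_infinite; do ?exact/submodule_image/submoduleT.
  exact: syzygy1_infinite p0 p1 lt01 M_fin G_free pd.
exact: syzygy3_infinite p0 p1 lt01 M_fin G_free pd noeth.
Qed.
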